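(* The extended symplectic eigenvalue map $\widehat{d}:\mathbb{P}_{2n}\to\mathbb{R}_+^{2n}$ is monotonic, i.e., for $A,B\in\mathbb{P}_{2n}$, $A\le B$ implies $\widehat{d}(A)\le\widehat{d}(B)$. Furthermore, for $A,B\in\mathbb{P}_{2n}$, $$d_T(\widehat{d}(A),\widehat{d}(B))\le d_T(A,B)\quad\text{and}\quad\delta(\widehat{d}(A),\widehat{d}(B))\le\sqrt{2n}\,\delta(A,B).$$
   Context: $\mathbb{P}_{2n}$ is the set of $2n\times2n$ real symmetric positive definite matrices; $A\le B$ means $B-A$ is positive semidefinite (Loewner order). The Riemannian distance is $\delta(A,B)=\|\log A^{-1/2}BA^{-1/2}\|_2$ with $\|X\|_2=(\operatorname{tr}X^2)^{1/2}$, and the Thompson metric is $d_T(A,B)=\|\log A^{-1/2}BA^{-1/2}\|$ with $\|\cdot\|$ the operator norm. $\mathbb{R}_+=(0,\infty)$, and $\mathbb{R}_+^{2n}$ is identified with the diagonal matrices in $\mathbb{P}_{2n}$; thus on $\mathbb{R}_+^{2n}$ the order is componentwise, $\delta(a,b)=\|\log a-\log b\|_2$, and $d_T(a,b)=\max_i|\log a_i-\log b_i|$. Let $J=\begin{bmatrix}0&I\\-I&0\end{bmatrix}$ and $\mathrm{Sp}(2n,\mathbb{R})=\{M\in M_{2n}(\mathbb{R}):M^TJM=J\}$. By Williamson's theorem, for each $A\in\mathbb{P}_{2n}$ there are a unique diagonal matrix $D=\mathrm{diag}(d_1,\dots,d_n)$ with $0<d_1\le\dots\le d_n$ and some $M\in\mathrm{Sp}(2n,\mathbb{R})$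 with $A=M^T\begin{bmatrix}D&0\\0&D\end{bmatrix}M$. The extended symplectic eigenvalue map is $\widehat{d}(A)=(\widehat d_1(A),\dots,\widehat d_{2n}(A))=(d_n,d_n,d_{n-1},d_{n-1},\dots,d_1,d_1)$. *)

(* Defs.v *)
From mathcomp Require Import all_boot all_order all_algebra.
From mathcomp Require Import boolp classical_sets reals exp.

Set Implicit Arguments.
Unset Strict Implicit.
Unset Printing Implicit Defensive.

Import Order.TTheory GRing.Theory Num.Theory.

Local Open Scope classical_set_scope.
Local Open Scope ring_scope.

Definition posdefmx (R : realType) (m : nat) (A : 'M[R]_m) : Prop :=
  A^T = A /\ forall v : 'cV[R]_m, v != 0 -> 0 < (v^T *m A *m v) 0 0.

Definition possemidefmx (R : realType) (m : nat) (A : 'M[R]_m) : Prop :=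
  A^T = A /\ forall v : 'cV[R]_m, 0 <= (v^T *m A *m v) 0 0.

Definition loewner_le (R : realType) (m : nat) (A B : 'M[R]_m) : Prop :=
  possemidefmx (B - A).

(* Spectral functional calculus f(X) of a symmetric matrix X = U^T diag(l) U;
   the value U^T diag(f(l)) U does not depend on the diagonalization chosen.
   The result is 0 when X is not orthogonally diagonalizable. *)
Definition spectral_map (R : realType) (m : nat) (f : R -> R) (X : 'M[R]_m) :
    'M[R]_m :=
  xget 0 [set Y | exists (U : 'M[R]_m) (l : 'rV[R]_m),
    [/\ U^T *m U = 1%:M,
        X = U^T *m diag_mx l *m U
      & Y = U^T *m diag_mx (map_mx f l) *m U]].

Definition logmx (R : realType) (m : nat) (X : 'M[R]_m) : 'M[R]_m :=
  spectral_map (@ln R) X.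

Definition invsqrtmx (R : realType) (m : nat) (X : 'M[R]_m) : 'M[R]_m :=
  spectral_map (fun x : R => (Num.sqrt x)^-1) X.

(* \tr (X *m X) is the squared Frobenius norm only for symmetric X, which is
   the only case used: X is a logmx below. *)
Definition frob_norm (R : realType) (m : nat) (X : 'M[R]_m) : R :=
  Num.sqrt (\tr (X *m X)).

Definition vec_norm2 (R : realType) (m : nat) (v : 'cV[R]_m) : R :=
  Num.sqrt (\sum_i v i 0 ^+ 2).

Definition op_norm (R : realType) (m : nat) (X : 'M[R]_m) : R :=
  sup [set vec_norm2 (X *m v) | v in [set v : 'cV[R]_m | vec_norm2 v = 1]].

Definition riem_dist (R : realType) (m : nat) (A B : 'M[R]_m) : R :=
  frob_norm (logmx (invsqrtmx A *m B *m invsqrtmx A)).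

Definition thompson_dist (R : realType) (m : nat) (A B : 'M[R]_m) : R :=
  op_norm (logmx (invsqrtmx A *m B *m invsqrtmx A)).

Definition symplJ (R : realType) (n : nat) : 'M[R]_(n + n) :=
  block_mx 0 1%:M (- 1%:M) 0.

Definition symplectic (R : realType) (n : nat) (M : 'M[R]_(n + n)) : Prop :=
  M^T *m symplJ R n *m M = symplJ R n.

Definition williamson_diag (R : realType) (n : nat) (A : 'M[R]_(n + n))
    (d : 'rV[R]_n) : Prop :=
  [/\ forall i, 0 < d 0 i,
      forall i j : 'I_n, (i <= j)%N -> d 0 i <= d 0 j
    & exists2 M : 'M[R]_(n + n), symplectic M &
        A = M^T *m block_mx (diag_mx d) 0 0 (diag_mx d) *m M].

(* By Williamson's theorem the set below is a singleton when A is positive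
   definite. *)
Definition sympl_eig (R : realType) (n : nat) (A : 'M[R]_(n + n)) : 'rV[R]_n :=
  xget 0 [set d | williamson_diag A d].

Lemma half_ord_subproof (n : nat) (i : 'I_(n + n)) : (i./2 < n)%N.
Proof. by rewrite ltn_half_double -addnn. Qed.

Definition half_ord (n : nat) (i : 'I_(n + n)) : 'I_n :=
  Ordinal (half_ord_subproof i).

(* (d_n, d_n, d_(n-1), d_(n-1), ..., d_1, d_1) *)
Definition dhat (R : realType) (n : nat) (A : 'M[R]_(n + n)) : 'rV[R]_(n + n) :=
  \row_i sympl_eig A 0 (rev_ord (half_ord i)).

(* Main.v *)
(* For symplectic M with A = M^T (D + D) M and coordinates z = M x, w = M y, the
   Hermitian form of A + itJ, viewed as a form in the real and imaginary parts
   (x, y), becomes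
     sum_i (d_i + t)/2 |z + J w|_i^2 + (d_i - t)/2 |z - J w|_i^2,
   so for t > 0 it has exactly #{i : d_i < t} negative squares.  Since the form
   increases with A in the Loewner order, a dimension count gives monotonicity
   of every d_i.
   If r bounds |log| of the spectrum of A^(-1/2) B A^(-1/2), then
   e^(-r) A <= B <= e^r A, so by monotonicity and homogeneity the log-ratios of
   the symplectic eigenvalues are bounded by r.  Taking for r the Thompson
   distance, then the Riemannian distance, gives the two inequalities.
   Existence of the Williamson form of A = L^T L comes from the orthogonal
   normal form of the skew matrix L^(-T) J L^(-1). *)
Require Import Defs.
From mathcomp Require Import all_boot all_order all_algebra.
From mathcomp Require Import fingroup perm.
From mathcomp Require Import boolp classical_sets reals exp.
From mathcomp Require Import sequences complex ring lra.

Set Implicit Arguments.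
Unset Strict Implicit.
Unset Printing Implicit Defensive.

Import Order.TTheory GRing.Theory Num.Theory.

Local Open Scope ring_scope.

(** * Real invariant pairs of a matrix *)

(** For a complex left eigenvector v = x + iy with eigenvalue a + ib, the two relations are the real
    and imaginary parts of v K = (a + ib) v. *)
Lemma real_invariant_pair (R : rcfType) (m : nat) (K : 'M[R]_m) :
  (0 < m)%N ->
  exists (a b : R) (x y : 'rV[R]_m),
    [/\ (x != 0) || (y != 0), x *m K = a *: x - b *: y
      & y *m K = b *: x + a *: y].
Proof.
move=> m_gt0.
pose KC := map_mx (@real_complex_def R (Phant R)) K.
have [[a b]] := eigenvalue_closed KC m_gt0.
move=> /eigenvalueP[v vK v_neq0].
exists a, b, (map_mx (@complex.Re R) v), (map_mx (@complex.Im R) v).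
have vKE j : (v *m KC) 0 j =
    ((map_mx (@complex.Re R) v *m K) 0 j +i*
     (map_mx (@complex.Im R) v *m K) 0 j)%C.
  rewrite !mxE; elim/big_ind3: _ => // [x1 x2 x3 y1 y2 y3 -> ->//|i _].
  by rewrite !mxE; case: (v 0 i) => p q /=; simpc.
split.
- apply: contraNT v_neq0; rewrite negb_or !negbK => /andP[/eqP x0 /eqP y0].
  apply/eqP/rowP => j; move/rowP/(_ j): x0; move/rowP/(_ j): y0; rewrite !mxE.
  by case: (v 0 j) => p q /= -> ->.
- apply/rowP => j; have := vKE j; rewrite vK !mxE.
  by case: (v 0 j) => p q /=; simpc => -[<- _]; ring.
- apply/rowP => j; have := vKE j; rewrite vK !mxE.
  by case: (v 0 j) => p q /=; simpc => -[_ <-]; ring.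
Qed.

(* P K^T = T P makes the orthogonal complement of the rows of P stable by K. *)
Lemma orth_invariant_pair (R : rcfType) (k m : nat) (K : 'M[R]_m)
    (P : 'M[R]_(k, m)) (T : 'M[R]_k) :
  (k < m)%N -> P *m K^T = T *m P ->
  exists (a b : R) (x y : 'rV[R]_m),
    [/\ (x != 0) || (y != 0), x *m K = a *: x - b *: y,
        y *m K = b *: x + a *: y, x *m P^T = 0 & y *m P^T = 0].
Proof.
move=> k_lt_m PK.
pose V := kermx P^T; pose B := row_base V.
have BV : (B :=: V)%MS := eq_row_base V.
have VP : B *m P^T = 0 by apply/sub_kermxP; rewrite BV.
have stabB : (B *m K <= B)%MS.
  rewrite BV; apply/sub_kermxP.
  have -> : B *m K *m P^T = B *m (P *m K^T)^T by rewrite trmx_mul trmxK mulmxA.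
  by rewrite PK trmx_mul mulmxA VP mul0mx.
have rV_gt0 : (0 < \rank V)%N.
  by rewrite mxrank_ker subn_gt0 (leq_ltn_trans _ k_lt_m)// rank_leq_col.
(* In the basis [B] of the orthogonal complement, [K] acts as the smaller matrix [C]; its invariant
   pair is carried back by [B]. *)
have [C BK] := submxP stabB.
have [a [b [x [y [xy_neq0 xC yC]]]]] := real_invariant_pair C rV_gt0.
have mulB_eq0 (z : 'rV_(\rank V)) : (z *m B == 0) = (z == 0).
  apply/eqP/eqP => [zB0|->]; last by rewrite mul0mx.
  by apply: (row_free_inj (row_base_free V)); rewrite zB0 mul0mx.
exists a, b, (x *m B), (y *m B); split.
- by rewrite !mulB_eq0.
- by rewrite -mulmxA BK mulmxA xC mulmxBl !scalemxAl.
- by rewrite -mulmxA BK mulmxA yC mulmxDl !scalemxAl.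
- by rewrite -mulmxA VP mulmx0.
- by rewrite -mulmxA VP mulmx0.
Qed.

(** * Inner product of row vectors *)

Definition rvdot (R : nzRingType) (m : nat) (u v : 'rV[R]_m) : R :=
  \sum_i u 0 i * v 0 i.

Lemma mulmx_rvdot (R : nzRingType) (m : nat) (u v : 'rV[R]_m) :
  u *m v^T = (rvdot u v)%:M.
Proof.
apply/matrixP => i j; rewrite !ord1 !mxE eqxx mulr1n.
by apply: eq_bigr => l _; rewrite mxE.
Qed.

Lemma rvdotE (R : nzRingType) (m : nat) (u v : 'rV[R]_m) :
  rvdot u v = (u *m v^T) 0 0.
Proof. by rewrite mulmx_rvdot !mxE eqxx. Qed.

Lemma rvdotC (R : comNzRingType) (m : nat) (u v : 'rV[R]_m) :
  rvdot u v = rvdot v u.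
Proof. by apply: eq_bigr => i _; rewrite mulrC. Qed.

Lemma rvdotDl (R : nzRingType) (m : nat) (u v w : 'rV[R]_m) :
  rvdot (u + v) w = rvdot u w + rvdot v w.
Proof. by rewrite !rvdotE mulmxDl mxE. Qed.

Lemma rvdotZl (R : nzRingType) (m : nat) (a : R) (u w : 'rV[R]_m) :
  rvdot (a *: u) w = a * rvdot u w.
Proof. by rewrite !rvdotE -scalemxAl mxE. Qed.

Lemma rvdotBl (R : nzRingType) (m : nat) (u v w : 'rV[R]_m) :
  rvdot (u - v) w = rvdot u w - rvdot v w.
Proof. by rewrite rvdotDl -scaleN1r rvdotZl mulN1r. Qed.

Lemma rvdot_adj (R : comNzRingType) (m : nat) (K : 'M[R]_m) (u v : 'rV[R]_m) :
  rvdot (u *m K) v = rvdot (v *m K^T) u.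
Proof. by rewrite rvdotC !rvdotE trmx_mul mulmxA. Qed.

Lemma rvdot_ge0 (R : realDomainType) (m : nat) (u : 'rV[R]_m) : 0 <= rvdot u u.
Proof. by apply: sumr_ge0 => i _; rewrite -expr2 sqr_ge0. Qed.

Lemma rvdot_eq0 (R : realDomainType) (m : nat) (u : 'rV[R]_m) :
  (rvdot u u == 0) = (u == 0).
Proof.
rewrite psumr_eq0 => [|i _]; last by rewrite -expr2 sqr_ge0.
apply/idP/idP => [/allP u0|/eqP->].
  apply/eqP/rowP => i; rewrite mxE; apply/eqP.
  by have := u0 i (mem_index_enum i); rewrite mulf_eq0 orbb.
by apply/allP => i _; rewrite mxE mulr0 eqxx.
Qed.

Lemma rvdot_gt0 (R : realDomainType) (m : nat) (u : 'rV[R]_m) :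
  (0 < rvdot u u) = (u != 0).
Proof. by rewrite lt0r rvdot_eq0 rvdot_ge0 andbT. Qed.

(** * Orthonormal frames for symmetric and skew matrices *)

Lemma orthonormal_extend (R : rcfType) (k m : nat) (E : 'M[R]_(k, m))
    (x : 'rV[R]_m) :
  E *m E^T = 1%:M -> rvdot x x = 1 -> x *m E^T = 0 ->
  col_mx E x *m (col_mx E x)^T = 1%:M.
Proof.
move=> EE xx xE; rewrite tr_col_mx mul_col_row EE xE mulmx_rvdot xx.
have -> : E *m x^T = 0 by apply: trmx_inj; rewrite trmx_mul trmxK xE trmx0.
by rewrite -scalar_mx_block.
Qed.

(** Induction on [k]: the orthogonal complement of the eigenvectors already found contains an
    invariant pair. Symmetry forces the imaginary part [b] of its eigenvalue to vanish, so a nonzero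
    vector of the pair is a new real eigenvector. *)
Lemma symmetric_partial_diag (R : rcfType) (m : nat) (S : 'M[R]_m) (k : nat) :
  S^T = S -> (k <= m)%N ->
  exists (E : 'M[R]_(k, m)) (l : 'rV[R]_k),
    E *m E^T = 1%:M /\ E *m S = diag_mx l *m E.
Proof.
move=> S_sym; elim: k => [_|k IHk k_lt_m].
  by exists 0, 0; split; rewrite [LHS]flatmx0 [RHS]flatmx0.
have [E [l [EE ES]]] := IHk (ltnW k_lt_m).
have ESt : E *m S^T = diag_mx l *m E by rewrite S_sym.
have [a [b [x [y [xy_neq0 xS yS xE yE]]]]] := orth_invariant_pair k_lt_m ESt.
have b0 : b = 0.
  have := rvdot_adj S x y.
  rewrite S_sym xS yS rvdotBl rvdotDl !rvdotZl (rvdotC y x) => dot.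
  have : b * (rvdot x x + rvdot y y) = 0 by lra.
  move=> /eqP; rewrite mulf_eq0 => /orP[/eqP//|].
  rewrite paddr_eq0 ?rvdot_ge0// !rvdot_eq0.
  by move: xy_neq0; rewrite -negb_and => /negbTE ->.
have {x y b xS yS xE yE b0 xy_neq0} [u u_neq0 [uS uE]] :
    exists2 u : 'rV_m, u != 0 & u *m S = a *: u /\ u *m E^T = 0.
  case/orP: xy_neq0 => [x_neq0|y_neq0]; [exists x|exists y] => //.
    by split=> //; rewrite xS b0 scale0r subr0.
  by split=> //; rewrite yS b0 scale0r add0r.
pose c := (Num.sqrt (rvdot u u))^-1.
have cc : c * c * rvdot u u = 1.
  rewrite -invfM -expr2 sqr_sqrtr ?rvdot_ge0//.
  by rewrite mulVf// rvdot_eq0.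
rewrite -addn1; exists (col_mx E (c *: u)), (row_mx l a%:M); split.
  apply: orthonormal_extend => //; last by rewrite -scalemxAl uE scaler0.
  by rewrite rvdotZl rvdotC rvdotZl mulrA.
rewrite diag_mx_row mul_block_col !mul0mx addr0 add0r mul_col_mx ES.
congr col_mx; rewrite -scalemxAl uS scalerA mulrC -scalerA -mul_scalar_mx.
by congr (_ *m _); apply/matrixP => i j; rewrite !ord1 !mxE eqxx.
Qed.

Lemma symmetric_diag (R : rcfType) (m : nat) (S : 'M[R]_m) :
  S^T = S ->
  exists (U : 'M[R]_m) (l : 'rV[R]_m),
    U^T *m U = 1%:M /\ S = U^T *m diag_mx l *m U.
Proof.
move=> S_sym; have [U [l [UU US]]] := symmetric_partial_diag S_sym (leqnn m).
exists U, l; have UtU := mulmx1C UU; split=> //.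
by rewrite -mulmxA -US mulmxA UtU mul1mx.
Qed.

(* A real invariant pair of a skew matrix has eigenvalues ib and -ib, and its
   two vectors are orthogonal of equal length, so that it extends the frame. *)
Lemma skew_partial_normal (R : rcfType) (m : nat) (K : 'M[R]_m) (k : nat) :
  K^T = - K -> K \in unitmx -> (k + k <= m)%N ->
  exists (E F : 'M[R]_(k, m)) (l : 'rV[R]_k),
    [/\ col_mx E F *m (col_mx E F)^T = 1%:M, forall i, 0 < l 0 i,
        E *m K = diag_mx l *m F & F *m K = - (diag_mx l *m E)].
Proof.
move=> K_skew K_unit; elim: k => [_|k IHk k_lt_m].
  exists 0, 0, 0; split; rewrite ?[LHS]flatmx0 ?[RHS]flatmx0//.
  by case.
have kk_lt_m : (k + k < m)%N.
  by apply: leq_trans k_lt_m; rewrite addSn ltnS addnS.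
have [E [F [l [PP l_gt0 EK FK]]]] := IHk (ltnW kk_lt_m).
pose P := col_mx E F.
have PKt : P *m K^T = block_mx 0 (- diag_mx l) (diag_mx l) 0 *m P.
  rewrite K_skew mul_block_col !mul0mx add0r addr0 mul_col_mx !mulmxN.
  by rewrite EK FK opprK mulNmx.
have [a [b [x [y [xy_neq0 xK yK xP yP]]]]] := orth_invariant_pair kk_lt_m PKt.
have skew_dot u v : rvdot (u *m K) v = - rvdot (v *m K) u.
  by rewrite rvdot_adj K_skew mulmxN -scaleN1r rvdotZl mulN1r.
(* The two diagonal instances give a|x|^2 = b<x,y> = -a|y|^2, so a = 0. Once b is known to be
   nonzero, they give <x,y> = 0, and the mixed instance gives |x| = |y|. *)
have := skew_dot x x; have := skew_dot y y; have := skew_dot x y.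
rewrite xK yK !rvdotBl !rvdotDl !rvdotZl (rvdotC y x).
set xx := rvdot x x; set yy := rvdot y y; set xy := rvdot x y => xKy yKy xKx.
have xxyy_gt0 : 0 < xx + yy.
  rewrite lt0r addr_ge0 ?rvdot_ge0// paddr_eq0 ?rvdot_ge0// !rvdot_eq0.
  by rewrite negb_and xy_neq0.
have a0 : a = 0.
  have : a * (xx + yy) = 0 by lra.
  by move=> /eqP; rewrite mulf_eq0 (gt_eqF xxyy_gt0) orbF => /eqP.
subst a.
have b_neq0 : b != 0.
  apply/eqP => b0; move: xK yK.
  rewrite b0 !scale0r subrr addr0 => xK0 yK0; move: xy_neq0.
  rewrite -[x](mulmxK K_unit) -[y](mulmxK K_unit) xK0 yK0 !mul0mx.
  by rewrite eqxx.
have xy0 : xy = 0.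
  by apply: (mulfI b_neq0); rewrite mulr0; lra.
have xxyy : xx = yy.
  by apply: (mulfI b_neq0); lra.
rewrite !scale0r add0r addr0 in xK yK.
have xx_gt0 : 0 < xx by lra.
(* Exchanging x and y changes the sign of b, so c = |b| can be used. *)
have {xKy yKy xKx xxyy_gt0 xy_neq0}
    [u [v [c [[c_gt0 uu vv uv] [uK vK uP vP]]]]] :
    exists (u v : 'rV[R]_m) (c : R),
    [/\ 0 < c, rvdot u u = xx, rvdot v v = xx & rvdot u v = 0] /\
    [/\ u *m K = c *: v, v *m K = - (c *: u), u *m P^T = 0 & v *m P^T = 0].
  case: (ltrgtP 0 b) b_neq0 => // [b_gt0 _|b_lt0 _].
    exists y, x, b; split; split=> //; first by rewrite rvdotC.
  exists x, y, (- b); split; split => //.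
  - by rewrite oppr_gt0.
  - by rewrite scaleNr.
  - by rewrite scaleNr opprK.
pose s := (Num.sqrt xx)^-1.
have ss : s * s * xx = 1.
  by rewrite -invfM -expr2 sqr_sqrtr ?(ltW xx_gt0)// mulVf// gt_eqF.
have [uE uF] : u *m E^T = 0 /\ u *m F^T = 0.
  by move: uP; rewrite tr_col_mx mul_mx_row -row_mx0 => /eq_row_mx.
have [vE vF] : v *m E^T = 0 /\ v *m F^T = 0.
  by move: vP; rewrite tr_col_mx mul_mx_row -row_mx0 => /eq_row_mx.
have [EE [EF [FE FF]]] : E *m E^T = 1%:M /\ E *m F^T = 0 /\
    F *m E^T = 0 /\ F *m F^T = 1%:M.
  move: PP; rewrite tr_col_mx mul_col_row scalar_mx_block.
  by move=> /eq_block_mx[].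
have tr0 (p : nat) (G : 'M[R]_(p, m)) (w : 'rV[R]_m) :
    w *m G^T = 0 -> G *m w^T = 0.
  by move=> wG; apply: trmx_inj; rewrite trmx_mul trmxK wG trmx0.
rewrite -addn1; exists (col_mx E (s *: u)), (col_mx F (s *: v)).
exists (row_mx l c%:M).
have svv : rvdot (s *: v) (s *: v) = 1.
  by rewrite rvdotZl rvdotC rvdotZl vv mulrA.
have suu : rvdot (s *: u) (s *: u) = 1.
  by rewrite rvdotZl rvdotC rvdotZl uu mulrA.
have diagc : diag_mx (c%:M : 'rV_1) = c%:M.
  by apply/matrixP => i j; rewrite !ord1 !mxE eqxx.
split.
- have suv : (s *: u) *m (s *: v)^T = 0.
    by rewrite mulmx_rvdot rvdotZl rvdotC rvdotZl rvdotC uv !mulr0 raddf0.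
  rewrite tr_col_mx mul_col_row !orthonormal_extend//;
    rewrite -?scalemxAl ?uE ?vF ?scaler0//.
  have svu : (s *: v) *m (s *: u)^T = 0.
    by apply: trmx_inj; rewrite trmx_mul trmxK suv trmx0.
  have suF : (s *: u) *m F^T = 0 by rewrite -scalemxAl uF scaler0.
  have svE : (s *: v) *m E^T = 0 by rewrite -scalemxAl vE scaler0.
  rewrite !tr_col_mx !mul_col_row EF FE suF svE suv svu.
  rewrite (tr0 _ _ _ suF) (tr0 _ _ _ svE).
  by rewrite !block_mx0 -scalar_mx_block.
- move=> i; rewrite mxE; case: splitP => j _ //.
  by rewrite ord1 mxE eqxx.
- rewrite diag_mx_row mul_block_col !mul0mx addr0 add0r mul_col_mx EK.
  by rewrite diagc mul_scalar_mx -scalemxAl uK !scalerA mulrC.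
- rewrite diag_mx_row mul_block_col !mul0mx addr0 add0r mul_col_mx FK.
  rewrite diagc mul_scalar_mx -scalemxAl vK opp_col_mx.
  by rewrite scalerN !scalerA mulrC.
Qed.

(** * The Hermitian form and monotonicity of symplectic eigenvalues *)

(* The Hermitian form of A + itJ (up to the sign of i) at the complex vector
   with real part x and imaginary part y. *)
Definition hform (R : realType) (n : nat) (t : R) (A : 'M[R]_(n + n))
    (x y : 'cV[R]_(n + n)) : R :=
  (x^T *m A *m x) 0 0 + (y^T *m A *m y) 0 0
  + 2 * t * (x^T *m symplJ R n *m y) 0 0.

Lemma hform_congr (R : realType) (n : nat) (t : R) (A M : 'M[R]_(n + n))
    (x y : 'cV[R]_(n + n)) :
  symplectic M -> hform t (M^T *m A *m M) x y = hform t A (M *m x) (M *m y).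
Proof.
move=> MJ; rewrite /hform -[in X in x^T *m X *m y]MJ.
by rewrite !trmx_mul !mulmxA.
Qed.

Lemma hform_le (R : realType) (n : nat) (t : R) (A B : 'M[R]_(n + n))
    (x y : 'cV[R]_(n + n)) :
  loewner_le A B -> hform t A x y <= hform t B x y.
Proof.
move=> [_ AB]; have := AB x; have := AB y.
rewrite !mulmxBr !mulmxBl ![(_ - _ : 'M_(_, _)) 0 0]mxE.
rewrite ![(- _ : 'M_(_, _)) 0 0]mxE /hform => hy hx.
by lra.
Qed.

Lemma quad_diag (R : realType) (n : nat) (d : 'rV[R]_n) (p q : 'cV[R]_n) :
  (p^T *m diag_mx d *m q) 0 0 = \sum_i d 0 i * p i 0 * q i 0.
Proof.
rewrite mxE; apply: eq_bigr => i _; rewrite mul_mx_diag !mxE.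
by rewrite [d 0 i * _]mulrC.
Qed.

(** [symplJ] exchanges the coordinates i and n + i up to sign, so it preserves the length of each
    such pair. The rest is the identity d (a^2 + b^2) + 2 t a b = (d + t)/2 (a + b)^2 + (d - t)/2 (a
    - b)^2, coordinate by coordinate. *)
Lemma hform_diag (R : realType) (n : nat) (t : R) (d : 'rV[R]_n)
    (z w : 'cV[R]_(n + n)) :
  let plus := z + symplJ R n *m w in let minus := z - symplJ R n *m w in
  hform t (block_mx (diag_mx d) 0 0 (diag_mx d)) z w =
  \sum_i ((d 0 i + t) / 2 *
            (plus (lshift n i) 0 ^+ 2 + plus (rshift n i) 0 ^+ 2)
          + (d 0 i - t) / 2 *
            (minus (lshift n i) 0 ^+ 2 + minus (rshift n i) 0 ^+ 2)).
Proof.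
rewrite /= /hform /symplJ.
rewrite -[z]vsubmxK -[w]vsubmxK; set p := usubmx z; set q := dsubmx z.
set p' := usubmx w; set q' := dsubmx w.
rewrite !tr_col_mx !mul_row_block !mul_row_col !mul_block_col.
rewrite !mulmx0 !mul0mx !add0r !addr0 !mulmx1 mulmxN mulmx1.
rewrite !mulNmx !mul1mx opp_col_mx !add_col_mx.
rewrite ![(_ + _ : 'M_1) 0 0]mxE ![(- _ : 'M_1) 0 0]mxE !quad_diag.
have dot (a b : 'cV[R]_n) : (a^T *m b) 0 0 = \sum_i a i 0 * b i 0.
  by rewrite mxE; apply: eq_bigr => i _; rewrite mxE.
rewrite !dot -!big_split/= -sumrN -big_split/= mulr_sumr -big_split/=.
by apply: eq_bigr => i _; rewrite !col_mxEu !col_mxEd !mxE; field.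
Qed.

Lemma symplJ_sqr (R : realType) (n : nat) :
  symplJ R n *m symplJ R n = - 1%:M.
Proof.
rewrite /symplJ mulmx_block !mulmx0 !mul0mx !add0r !addr0 !mulmx1 mul1mx.
by rewrite [in RHS]scalar_mx_block opp_block_mx !oppr0.
Qed.

Lemma symplJ_unit (R : realType) (n : nat) : symplJ R n \in unitmx.
Proof.
have /mulmx1_unit[//] : symplJ R n *m - symplJ R n = 1%:M.
by rewrite mulmxN symplJ_sqr opprK.
Qed.

Lemma symplectic_unit (R : realType) (n : nat) (M : 'M[R]_(n + n)) :
  symplectic M -> M \in unitmx.
Proof.
by move=> MJ; move: (symplJ_unit R n); rewrite -MJ unitmx_mul => /andP[].
Qed.

(** Serves as the dimension count: a square homogeneous system with a vacuous equation has a nonzero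
    solution. *)
Lemma singular_row0 (F : fieldType) (m : nat) (G : 'M[F]_m) (j : 'I_m) :
  (forall i, G j i = 0) -> exists2 z : 'cV[F]_m, z != 0 & G *m z = 0.
Proof.
move=> Gj0; have : \det G^T == 0.
  rewrite det_tr; apply/det0P; exists (delta_mx 0 j).
    by apply/eqP => /rowP/(_ j)/eqP; rewrite !mxE !eqxx oner_eq0.
  by rewrite -rowE; apply/rowP => i; rewrite !mxE Gj0.
move=> /det0P[v v_neq0 vG]; exists v^T.
  by apply: contra_neq v_neq0 => /(congr1 trmx); rewrite trmxK trmx0.
by apply: trmx_inj; rewrite trmx_mul trmxK vG trmx0.
Qed.

(** By contradiction: if e_j < t = d_j, some pair of vectors makes the form of A nonnegative and
    that of B negative. The case A = B also yields uniqueness of the Williamson diagonal. *)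
Lemma williamson_le (R : realType) (n : nat) (A B : 'M[R]_(n + n))
    (d e : 'rV[R]_n) (j : 'I_n) :
  williamson_diag A d -> williamson_diag B e -> loewner_le A B ->
  d 0 j <= e 0 j.
Proof.
move=> [d_gt0 d_homo [M MJ AE]] [e_gt0 e_homo [N NJ BE]] AB.
rewrite leNgt; apply/negP => ed; pose t := d 0 j.
have N_unit := symplectic_unit NJ.
(* On the pairs N^-1 z, N^-1 (J z) only the e_i - t squares of the form of B
   survive.  Requiring z_i = 0 for i > j makes it negative, and requiring
   (T z)_i = 0 for i < j makes the form of A nonnegative: these are 2n - 2
   equations in 2n unknowns. *)
pose J := symplJ R n.
pose T : 'M[R]_(n + n) := M *m invmx N - J *m M *m invmx N *m J.
pose eqns (s : 'I_n -> 'I_(n + n)) := \matrix_(i < n, b < n + n)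
  (if (i < j)%N then T (s i) b else if (j < i)%N then (s i == b)%:R else 0).
have eqns_j s b : eqns s j b = 0 by rewrite mxE ltnn.
have [z z_neq0 Gz] : exists2 z : 'cV[R]_(n + n), z != 0 &
    col_mx (eqns (@lshift n n)) (eqns (@rshift n n)) *m z = 0.
  by apply: (@singular_row0 _ _ _ (lshift n j)) => b; rewrite col_mxEu eqns_j.
have [upz dnz] : eqns (@lshift n n) *m z = 0 /\ eqns (@rshift n n) *m z = 0.
  by move: Gz; rewrite mul_col_mx -col_mx0 => /eq_col_mx.
have eqns_lt s (i : 'I_n) : eqns s *m z = 0 -> (i < j)%N ->
    (T *m z) (s i) 0 = 0.
  move=> /colP/(_ i) + ij; rewrite !mxE => rz; rewrite -[RHS]rz.
  by apply: eq_bigr => b _; rewrite !mxE ij.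
have eqns_gt s (i : 'I_n) : eqns s *m z = 0 -> (j < i)%N -> z (s i) 0 = 0.
  move=> /colP/(_ i) + ij; rewrite !mxE => rz; rewrite -[RHS]rz.
  rewrite (bigD1 (s i))//= big1 => [|b b_neq].
    by rewrite !mxE ltnNge (ltnW ij)/= ij eqxx mul1r addr0.
  by rewrite !mxE ltnNge (ltnW ij)/= ij eq_sym (negbTE b_neq) mul0r.
pose x := invmx N *m z; pose y := invmx N *m (J *m z).
(* The vector [minus] of [hform_diag] is T z here. Its i-th square vanishes for i < j, and has
   coefficient d_i - d_j >= 0 up to a factor 1/2 otherwise. *)
have hA : 0 <= hform t A x y.
  rewrite AE hform_congr// hform_diag; apply: sumr_ge0 => i _.
  have -> : M *m x - symplJ R n *m (M *m y) = T *m z.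
    by rewrite /T /x /y mulmxBl !mulmxA.
  apply: addr_ge0.
    apply: mulr_ge0; last by rewrite addr_ge0 ?sqr_ge0.
    by apply: divr_ge0 => //; apply: addr_ge0; apply/ltW/d_gt0.
  case: (ltnP i j) => ij; first by rewrite !eqns_lt// expr0n/= !addr0 mulr0.
  apply: mulr_ge0; last by rewrite addr_ge0 ?sqr_ge0.
  by rewrite divr_ge0// subr_ge0 d_homo.
(* In the coordinates of N the pair is (z, J z), and J J = -1 makes [plus] vanish and [minus] equal
   2z. The form is then the sum of 2 (e_i - t) |z|_i^2, where only i <= j contribute. *)
have hB : hform t B x y < 0.
  rewrite BE hform_congr// hform_diag /x /y !mulKVmx// !mulmxA symplJ_sqr.
  rewrite mulNmx mul1mx subrr opprK.
  apply: le_lt_trans (_ : (e 0 j - t) * 2 * rvdot z^T z^T < 0).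
    rewrite /rvdot big_split_ord/= -big_split/= mulr_sumr.
    apply: ler_sum => i _; rewrite !mxE.
    case: (ltnP j i) => ij; first by rewrite !eqns_gt//; lra.
    have := e_homo _ _ ij.
    have := sqr_ge0 (z (lshift n i) 0); have := sqr_ge0 (z (rshift n i) 0).
    by nra.
  have zT_neq0 : z^T != 0.
    by apply: contra_neq z_neq0 => /(congr1 trmx); rewrite trmxK trmx0.
  rewrite pmulr_llt0; last by rewrite rvdot_gt0.
  by rewrite pmulr_llt0// subr_lt0.
by have := hform_le t x y AB; rewrite leNgt (lt_le_trans hB hA).
Qed.

(** * Existence of the Williamson form *)

Lemma posdefmx_diag (R : realType) (m : nat) (A : 'M[R]_m) :
  posdefmx A ->
  exists (U : 'M[R]_m) (l : 'rV[R]_m),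
    [/\ U^T *m U = 1%:M, A = U^T *m diag_mx l *m U & forall i, 0 < l 0 i].
Proof.
move=> [A_sym A_pos]; have [U [l [UtU AE]]] := symmetric_diag A_sym.
exists U, l; split=> // i.
have UUt := mulmx1C UtU.
(* At the i-th eigenvector the quadratic form takes the value l_i. *)
have := A_pos (U^T *m delta_mx i 0); rewrite AE trmx_mul trmxK !mulmxA.
rewrite -[_ *m U *m U^T]mulmxA UUt mulmx1 -[_ *m U *m U^T]mulmxA UUt mulmx1.
rewrite quad_diag (bigD1 i)//= big1 => [|k /negbTE ki].
  rewrite !mxE !eqxx !mulr1 addr0; apply.
  apply/eqP => /(congr1 (mulmx U)); rewrite mulmxA UUt mul1mx mulmx0.
  by move=> /colP/(_ i)/eqP; rewrite !mxE !eqxx oner_eq0.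
by rewrite !mxE ki mulr0.
Qed.

Lemma sort_row (R : realType) (n : nat) (l : 'rV[R]_n) :
  exists s : 'S_n, forall i j : 'I_n, (i <= j)%N -> l 0 (s i) <= l 0 (s j).
Proof.
pose t := [tuple l 0 i | i < n].
have /tuple_permP[s st] : perm_eq (sort <=%R t) t by rewrite perm_sort.
exists s => i j ij.
have nthE k : nth 0 (sort <=%R t) (k : 'I_n) = l 0 (s k).
  by rewrite st -tnth_nth !tnth_mktuple.
rewrite -!nthE; apply: sorted_leq_nth => //.
- exact: le_trans.
- by apply: sort_le_sorted.
- by rewrite inE size_sort size_tuple.
- by rewrite inE size_sort size_tuple.
Qed.

(** The frame of [skew_partial_normal] with n planes, reordered. The parameters are stated through
    their reciprocals [d] because these become the symplectic eigenvalues. *)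
Lemma skew_normal (R : realType) (n : nat) (K : 'M[R]_(n + n)) :
  K^T = - K -> K \in unitmx ->
  exists (O : 'M[R]_(n + n)) (d : 'rV[R]_n),
    [/\ O^T *m O = 1%:M, forall i, 0 < d 0 i,
        forall i j : 'I_n, (i <= j)%N -> d 0 i <= d 0 j
      & O *m K *m O^T = block_mx 0 (diag_mx (map_mx GRing.inv d))
                                 (- diag_mx (map_mx GRing.inv d)) 0].
Proof.
move=> K_skew K_unit.
have [E [F [l [PP l_gt0 EK FK]]]]
  := skew_partial_normal K_skew K_unit (leqnn _).
have [s s_homo] := sort_row (map_mx GRing.inv l).
(* The same permutation acts on both halves, so that the planes stay paired. *)
pose Q := block_mx (perm_mx s) 0 0 (perm_mx s) : 'M[R]_(n + n).
have ss : perm_mx s *m (perm_mx s)^T = 1%:M :> 'M[R]_n.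
  by rewrite tr_perm_mx -perm_mxM mulgV perm_mx1.
have QQ : Q *m Q^T = 1%:M.
  rewrite tr_block_mx mulmx_block !trmx0 !mulmx0 !mul0mx !addr0 !add0r ss.
  by rewrite -scalar_mx_block.
have conj_diag (D : 'rV[R]_n) :
    perm_mx s *m diag_mx D *m (perm_mx s)^T = diag_mx (\row_i D 0 (s i)).
  rewrite tr_perm_mx -row_permE -col_permE.
  apply/matrixP => i j; rewrite !mxE.
  by rewrite (inj_eq perm_inj).
exists (Q *m col_mx E F), (\row_i (l 0 (s i))^-1); split.
- by apply: mulmx1C; rewrite trmx_mul !mulmxA -(mulmxA Q) PP mulmx1 QQ.
- by move=> i; rewrite mxE invr_gt0.
- by move=> i j /s_homo; rewrite !mxE.
have -> : Q *m col_mx E F *m K *m (Q *m col_mx E F)^T =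
    Q *m (block_mx 0 (diag_mx l) (- diag_mx l) 0) *m Q^T.
  rewrite trmx_mul !mulmxA; congr (_ *m _).
  rewrite -!mulmxA; congr (_ *m _); rewrite !mulmxA mul_col_mx EK FK.
  have -> : col_mx (diag_mx l *m F) (- (diag_mx l *m E)) =
      block_mx 0 (diag_mx l) (- diag_mx l) 0 *m col_mx E F.
    by rewrite mul_block_col !mul0mx add0r addr0 mulNmx.
  by rewrite -mulmxA PP mulmx1.
rewrite tr_block_mx !mulmx_block !trmx0 !mulmx0 !mul0mx !addr0 !add0r.
rewrite mulmxN mulNmx !mul0mx conj_diag.
have -> // : map_mx GRing.inv (\row_i (l 0 (s i))^-1) = \row_i l 0 (s i).
by apply/rowP => i; rewrite !mxE invrK.
Qed.

Lemma posdefmx_factor (R : realType) (m : nat) (A : 'M[R]_m) :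
  posdefmx A -> exists2 L : 'M[R]_m, L \in unitmx & A = L^T *m L.
Proof.
move=> /posdefmx_diag[U [l [UtU AE l_gt0]]].
exists (diag_mx (map_mx Num.sqrt l) *m U).
  rewrite unitmx_mul (mulmx1_unit UtU).2 andbT unitmxE det_diag unitfE.
  by apply/prodf_neq0 => i _; rewrite mxE gt_eqF// sqrtr_gt0.
rewrite trmx_mul tr_diag_mx mulmxA -[_ *m diag_mx _ *m diag_mx _]mulmxA.
rewrite mulmx_diag AE; congr (_ *m diag_mx _ *m _); apply/rowP => i.
by rewrite !mxE -expr2 sqr_sqrtr// ltW.
Qed.

(** With [D2] the inverse square root of D + D, the witness is M = D2 O L. Since D2 J D2 = O K O^T,
    one gets M^T J M = L^T K L = J, while D2 (D + D) D2 = 1 gives back L^T L = A. *)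
Lemma williamson_exists (R : realType) (n : nat) (A : 'M[R]_(n + n)) :
  posdefmx A -> exists d : 'rV[R]_n, williamson_diag A d.
Proof.
move=> /posdefmx_factor[L L_unit LL].
have [Li [Li_unit LiL]] : exists Li, Li \in unitmx /\ Li *m L = 1%:M.
  by exists (invmx L); rewrite unitmx_inv mulVmx.
have J_skew : (symplJ R n)^T = - symplJ R n.
  rewrite /symplJ tr_block_mx opp_block_mx !trmx0 !oppr0 opprK.
  by rewrite linearN/= trmx1.
pose K := Li^T *m symplJ R n *m Li.
have K_skew : K^T = - K.
  by rewrite /K !trmx_mul trmxK J_skew mulNmx mulmxN mulmxA.
have K_unit : K \in unitmx.
  by rewrite /K !unitmx_mul unitmx_tr Li_unit symplJ_unit.
have [O [d [OO d_gt0 d_homo OKO]]] := skew_normal K_skew K_unit.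
exists d; split=> //.
pose s := diag_mx (map_mx (fun x => (Num.sqrt x)^-1) d).
pose D2 := block_mx s 0 0 s.
have D2_sym : D2^T = D2 by rewrite /D2 tr_block_mx !trmx0 tr_diag_mx.
have ss : s *m s = diag_mx (map_mx GRing.inv d).
  rewrite mulmx_diag; congr diag_mx; apply/rowP => i.
  by rewrite !mxE -invfM -expr2 sqr_sqrtr// ltW.
have sds : s *m diag_mx d *m s = 1%:M.
  rewrite !mulmx_diag -diag_const_mx; congr diag_mx; apply/rowP => i.
  rewrite !mxE mulrAC -invfM -expr2 sqr_sqrtr ?ltW// mulVf//.
  by rewrite gt_eqF.
exists (D2 *m O *m L).
  rewrite /symplectic !trmx_mul D2_sym.
  have -> : L^T *m (O^T *m D2) *m symplJ R n *m (D2 *m O *m L) =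
      L^T *m (O^T *m (D2 *m symplJ R n *m D2) *m O) *m L by rewrite !mulmxA.
  have -> : D2 *m symplJ R n *m D2 = O *m K *m O^T.
    rewrite OKO !mulmx_block !mulmx0 !mul0mx !addr0 !add0r.
    by rewrite mulmxN mulmx1 mulNmx !mul0mx ss.
  have -> : O^T *m (O *m K *m O^T) *m O = K.
    by rewrite !mulmxA OO mul1mx -mulmxA OO mulmx1.
  rewrite /K !mulmxA -trmx_mul LiL trmx1 mul1mx -mulmxA LiL mulmx1.
  by [].
rewrite !trmx_mul D2_sym LL.
set DD := block_mx (diag_mx d) 0 0 (diag_mx d).
have -> : L^T *m (O^T *m D2) *m DD *m (D2 *m O *m L) =
   L^T *m (O^T *m (D2 *m DD *m D2) *m O) *m L by rewrite !mulmxA.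
rewrite !mulmx_block ?(mulmx0, mul0mx, addr0, add0r) sds.
by rewrite -scalar_mx_block mulmx1 OO mulmx1.
Qed.

Lemma sympl_eigP (R : realType) (n : nat) (A : 'M[R]_(n + n)) :
  posdefmx A -> williamson_diag A (sympl_eig A).
Proof. by move=> /williamson_exists; apply: xgetPex. Qed.

(** * Order and scaling of the extended symplectic eigenvalues *)

Lemma dhat_le (R : realType) (n : nat) (A B : 'M[R]_(n + n)) i :
  posdefmx A -> posdefmx B -> loewner_le A B -> dhat A 0 i <= dhat B 0 i.
Proof.
move=> /sympl_eigP wA /sympl_eigP wB AB; rewrite !mxE.
exact: williamson_le wA wB AB.
Qed.

Lemma dhat_gt0 (R : realType) (n : nat) (A : 'M[R]_(n + n)) i :
  posdefmx A -> 0 < dhat A 0 i.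
Proof. by move=> /sympl_eigP[A_gt0 _ _]; rewrite mxE. Qed.

Lemma posdefmxZ (R : realType) (m : nat) (c : R) (A : 'M[R]_m) :
  0 < c -> posdefmx A -> posdefmx (c *: A).
Proof.
move=> c_gt0 [A_sym A_pos]; split; first by rewrite linearZ/= A_sym.
by move=> v /A_pos Av; rewrite -scalemxAr -scalemxAl mxE mulr_gt0.
Qed.

Lemma loewner_le_refl (R : realType) (m : nat) (A : 'M[R]_m) : loewner_le A A.
Proof.
by rewrite /loewner_le subrr; split=> [|v]; rewrite ?trmx0// mulmx0 mul0mx mxE.
Qed.

(** The same M shows that c d is a Williamson diagonal of c A; uniqueness comes from [williamson_le]
    used in both directions. *)
Lemma dhatZ (R : realType) (n : nat) (c : R) (A : 'M[R]_(n + n)) i :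
  0 < c -> posdefmx A -> dhat (c *: A) 0 i = c * dhat A 0 i.
Proof.
move=> c_gt0 pA; have [d_gt0 d_homo [M MJ AE]] := sympl_eigP pA.
have wcA : williamson_diag (c *: A) (c *: sympl_eig A).
  split=> [j|j k jk|]; first by rewrite mxE mulr_gt0.
    by rewrite !mxE ler_pM2l// d_homo.
  exists M => //; rewrite [in LHS]AE !linearZ/= -[in RHS](scaler0 _ c).
  by rewrite -scale_block_mx -!scalemxAr -!scalemxAl.
have wcA' := sympl_eigP (posdefmxZ c_gt0 pA).
apply/le_anti; rewrite !mxE.
have le1 := williamson_le (rev_ord (half_ord i)) wcA wcA' (loewner_le_refl _).
have le2 := williamson_le (rev_ord (half_ord i)) wcA' wcA (loewner_le_refl _).
by move: le1 le2; rewrite !mxE => -> ->.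
Qed.

(** * Spectral calculus *)

(** Entrywise, l_j = k_i wherever W_ij is nonzero, and f preserves this equality. *)
Lemma diag_mx_intertwine (R : idomainType) (m : nat) (f : R -> R)
    (W : 'M[R]_m) (l k : 'rV[R]_m) :
  W *m diag_mx l = diag_mx k *m W ->
  W *m diag_mx (map_mx f l) = diag_mx (map_mx f k) *m W.
Proof.
move=> /matrixP Wl; apply/matrixP => i j; have := Wl i j.
rewrite !mul_mx_diag !mul_diag_mx !mxE.
have [->|W_neq0] := eqVneq (W i j) 0; first by rewrite !mul0r !mulr0.
by rewrite mulrC => /(mulIf W_neq0) ->; rewrite mulrC.
Qed.

(** For two diagonalizations U and V of one matrix, V U^T intertwines the two diagonals, hence also
    their images under f. *)
Lemma spectral_mapE (R : realType) (m : nat) (f : R -> R) (U : 'M[R]_m)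
    (l : 'rV[R]_m) :
  U^T *m U = 1%:M ->
  spectral_map f (U^T *m diag_mx l *m U) = U^T *m diag_mx (map_mx f l) *m U.
Proof.
move=> UU; apply: xget_unique; first by exists U, l.
move=> Y [V [k [VV UV ->]]].
have UU' := mulmx1C UU; have VV' := mulmx1C VV.
pose W := V *m U^T.
have Wl : W *m diag_mx l = diag_mx k *m W.
  have /(congr1 (fun X => V *m X *m U^T)) := UV.
  rewrite !mulmxA VV' mul1mx -[_ *m U *m U^T]mulmxA UU' mulmx1.
  by rewrite /W ?mulmxA.
have Wf := diag_mx_intertwine f Wl.
have -> : U^T *m diag_mx (map_mx f l) *m U =
    V^T *m (W *m diag_mx (map_mx f l)) *m U.
  by rewrite /W !mulmxA VV mul1mx.
by rewrite Wf /W !mulmxA -[_ *m U^T *m U]mulmxA UU mulmx1.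
Qed.

Lemma spectral_map_diag (R : realType) (m : nat) (f : R -> R) (l : 'rV[R]_m) :
  spectral_map f (diag_mx l) = diag_mx (map_mx f l).
Proof.
have := @spectral_mapE _ _ f 1%:M l.
by rewrite trmx1 !mul1mx !mulmx1; apply.
Qed.

(** * Operator and Frobenius norms *)

Lemma vec_norm2_orth (R : realType) (m : nat) (U : 'M[R]_m) (v : 'cV[R]_m) :
  U^T *m U = 1%:M -> vec_norm2 (U *m v) = vec_norm2 v.
Proof.
move=> UU; have sumE (w : 'cV[R]_m) : \sum_i w i 0 ^+ 2 = (w^T *m w) 0 0.
  by rewrite mxE; apply: eq_bigr => i _; rewrite mxE.
by rewrite /vec_norm2 !sumE trmx_mul mulmxA -[_ *m U^T *m U]mulmxA UU mulmx1.
Qed.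

Lemma vec_norm2_diag_le (R : realType) (m : nat) (r : R) (l : 'rV[R]_m)
    (v : 'cV[R]_m) :
  0 <= r -> (forall i, `|l 0 i| <= r) ->
  vec_norm2 (diag_mx l *m v) <= r * vec_norm2 v.
Proof.
move=> r_ge0 lr; rewrite /vec_norm2 -[r in r * _]ger0_norm// -sqrtr_sqr.
rewrite -sqrtrM ?sqr_ge0// ler_wsqrtr// mulr_sumr; apply: ler_sum => i _.
rewrite mul_diag_mx mxE exprMn ler_wpM2r ?sqr_ge0//.
by rewrite -[l 0 i ^+ 2]real_normK ?num_real// lerXn2r// nnegrE.
Qed.

Lemma op_norm_ge0 (R : realType) (m : nat) (X : 'M[R]_m) : 0 <= op_norm X.
Proof.
rewrite /op_norm; set S := (X in sup X).
(* [sup] defaults to 0 when there is no supremum, as for m = 0, where no vector has norm 1. *)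
have [supS|/sup_out -> //] := pselect (has_sup S).
have [_ [v v1 _]] := supS.1.
apply: le_trans (sqrtr_ge0 _ : 0 <= vec_norm2 (X *m v)) _.
by apply: ub_le_sup; [exact: supS.2 | exists v].
Qed.

Lemma op_norm_diag_le (R : realType) (m : nat) (r : R) (l : 'rV[R]_m) :
  0 <= r -> (forall i, `|l 0 i| <= r) -> op_norm (diag_mx l) <= r.
Proof.
move=> r_ge0 lr; rewrite /op_norm.
set S := (X in sup X).
have [->|S_neq0] := eqVneq S set0; first by rewrite sup0.
apply: ge_sup; first exact/set0P.
move=> _ [v /= v1 <-]; apply: le_trans (vec_norm2_diag_le v r_ge0 lr) _.
by rewrite v1 mulr1.
Qed.

Lemma ler_op_norm (R : realType) (m : nat) (U : 'M[R]_m) (l : 'rV[R]_m) i :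
  U^T *m U = 1%:M -> `|l 0 i| <= op_norm (U^T *m diag_mx l *m U).
Proof.
move=> UU; have UU' := mulmx1C UU.
have UTU : U^T^T *m U^T = 1%:M by rewrite trmxK.
have normE (v : 'cV[R]_m) :
    vec_norm2 (U^T *m diag_mx l *m U *m v) = vec_norm2 (diag_mx l *m (U *m v)).
  by rewrite -!mulmxA vec_norm2_orth.
have delta_norm (c : R) : vec_norm2 (c *: delta_mx i 0 : 'cV[R]_m) = `|c|.
  rewrite /vec_norm2 (bigD1 i)//= big1 => [|j /negbTE ji].
    by rewrite !mxE !eqxx mulr1 addr0 sqrtr_sqr.
  by rewrite !mxE ji mulr0 expr0n.
apply: ub_le_sup.
  (* Any upper bound suffices for the supremum to exist; the sum dominates every |l_j|. *)
  exists (\sum_j `|l 0 j|) => _ [v /= v1 <-]; rewrite normE.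
  apply: le_trans (@vec_norm2_diag_le _ _ (\sum_j `|l 0 j|) _ _ _ _) _.
  - by apply: sumr_ge0.
  - by move=> j; rewrite (bigD1 j)//= lerDl sumr_ge0.
  - by rewrite vec_norm2_orth// v1 mulr1.
(* The unit eigenvector for l_i is stretched by exactly |l_i|. *)
exists (U^T *m delta_mx i 0) => /=.
  by rewrite vec_norm2_orth// -[delta_mx _ _]scale1r delta_norm normr1.
rewrite normE [U *m _]mulmxA UU' mul1mx -delta_norm; congr vec_norm2.
apply/colP => j; rewrite mul_diag_mx !mxE.
by have [->|] := eqVneq j i; rewrite ?mulr0.
Qed.

Lemma frob_normE (R : realType) (m : nat) (U : 'M[R]_m) (l : 'rV[R]_m) :
  U^T *m U = 1%:M ->
  frob_norm (U^T *m diag_mx l *m U) = Num.sqrt (\sum_i l 0 i ^+ 2).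
Proof.
move=> /mulmx1C UU; rewrite /frob_norm; congr Num.sqrt.
rewrite !mulmxA -[_ *m U *m U^T]mulmxA UU mulmx1 mxtrace_mulC !mulmxA UU mul1mx.
rewrite mulmx_diag mxtrace_diag; apply: eq_bigr => i _.
by rewrite mxE expr2.
Qed.

(** * Logarithmic ratios and the distance bounds *)

Lemma log_ratio_diag (R : realType) (m : nat) (a b : 'rV[R]_m) :
  (forall i, 0 < a 0 i) ->
  logmx (invsqrtmx (diag_mx a) *m diag_mx b *m invsqrtmx (diag_mx a))
  = diag_mx (\row_i ln (b 0 i / a 0 i)).
Proof.
move=> a_gt0; rewrite /logmx /invsqrtmx spectral_map_diag !mulmx_diag.
rewrite spectral_map_diag; congr diag_mx; apply/rowP => i; rewrite !mxE.
by rewrite mulrAC -invfM -expr2 sqr_sqrtr 1?mulrC// ltW.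
Qed.

(** Simultaneous congruence: with S = A^(1/2), T = A^(-1/2) and U diagonalizing T B T, the matrix V
    = U S carries the identity to A and the diagonal of [mu] to B. *)
Lemma log_ratio_spec (R : realType) (m : nat) (A B : 'M[R]_m) :
  posdefmx A -> posdefmx B ->
  exists (U V : 'M[R]_m) (mu : 'rV[R]_m),
    [/\ U^T *m U = 1%:M, forall i, 0 < mu 0 i, A = V^T *m V,
        B = V^T *m diag_mx mu *m V
      & logmx (invsqrtmx A *m B *m invsqrtmx A)
        = U^T *m diag_mx (map_mx (@ln R) mu) *m U].
Proof.
move=> pA [B_sym B_pos]; have [W [a [WW AE a_gt0]]] := posdefmx_diag pA.
have WW' := mulmx1C WW.
(* [g f] is f(A), and [gM] makes it multiplicative in f. *)
pose g f := W^T *m diag_mx (map_mx f a) *m W.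
pose T := g (fun x => (Num.sqrt x)^-1); pose S := g Num.sqrt.
have gM f h : g f *m g h = g (fun x => f x * h x).
  rewrite /g !mulmxA -[_ *m W *m W^T]mulmxA WW' mulmx1.
  rewrite -[_ *m diag_mx _ *m diag_mx _]mulmxA mulmx_diag.
  by congr (_ *m diag_mx _ *m _); apply/rowP => i; rewrite !mxE.
have g_sym f : (g f)^T = g f by rewrite !trmx_mul trmxK tr_diag_mx mulmxA.
have TS : T *m S = 1%:M.
  rewrite gM /g -[RHS]WW -[in RHS](mulmx1 W^T) -diag_const_mx.
  congr (_ *m diag_mx _ *m _); apply/rowP => i; rewrite !mxE mulVf//.
  by rewrite gt_eqF// sqrtr_gt0.
have ST := mulmx1C TS.
have SS : A = S^T *m S.
  rewrite g_sym gM AE; congr (_ *m diag_mx _ *m _); apply/rowP => i.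
  by rewrite !mxE -expr2 sqr_sqrtr// ltW.
have TE : invsqrtmx A = T by rewrite /invsqrtmx AE spectral_mapE.
have T_sym : T^T = T := g_sym _.
have S_sym : S^T = S := g_sym _.
clearbody T S.
have pTBT : posdefmx (T *m B *m T).
  split; first by rewrite !trmx_mul B_sym T_sym mulmxA.
  move=> v v_neq0; rewrite !mulmxA -{1}T_sym -trmx_mul -mulmxA; apply: B_pos.
  apply: contra_neq v_neq0 => /(congr1 (mulmx S)).
  by rewrite mulmxA ST mul1mx mulmx0.
have [U [mu [UU TBT mu_gt0]]] := posdefmx_diag pTBT.
exists U, (U *m S), mu; split => //.
- by rewrite trmx_mul mulmxA -[_ *m U^T *m U]mulmxA UU mulmx1.
- rewrite trmx_mul S_sym.
  have -> : S *m U^T *m diag_mx mu *m (U *m S) =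
      S *m (U^T *m diag_mx mu *m U) *m S by rewrite !mulmxA.
  by rewrite -TBT !mulmxA ST mul1mx -mulmxA TS mulmx1.
- by rewrite /logmx TE TBT spectral_mapE.
Qed.

(** After the common congruence by V, the comparisons of B with e^(-r) A and e^r A reduce to
    entrywise bounds on [mu]. *)
Lemma dhat_log_ratio (R : realType) (n : nat) (A B V : 'M[R]_(n + n))
    (mu : 'rV[R]_(n + n)) (r : R) :
  posdefmx A -> posdefmx B ->
  A = V^T *m V -> B = V^T *m diag_mx mu *m V ->
  (forall i, 0 < mu 0 i) -> (forall i, `|ln (mu 0 i)| <= r) ->
  forall i, `|ln (dhat B 0 i / dhat A 0 i)| <= r.
Proof.
move=> pA pB AE BE mu_gt0 mu_r i.
have mu_le k : expR (- r) <= mu 0 k <= expR r.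
  rewrite -[mu 0 k]lnK ?posrE// !ler_expR -ler_norml.
  exact: mu_r.
have quad_le (D : 'rV[R]_(n + n)) : (forall k, 0 <= D 0 k) ->
    forall v : 'cV[R]_(n + n), 0 <= (v^T *m (V^T *m diag_mx D *m V) *m v) 0 0.
  move=> D_ge0 v; rewrite !mulmxA -trmx_mul -[_ *m V *m v]mulmxA quad_diag.
  apply: sumr_ge0 => k _.
  by rewrite -mulrA -expr2 mulr_ge0 ?sqr_ge0.
have scaleAE (c : R) : c *: A = V^T *m diag_mx (const_mx c) *m V.
  by rewrite diag_const_mx mul_mx_scalar AE scalemxAl.
have leAB : loewner_le (expR (- r) *: A) B.
  split; first by rewrite linearB/= linearZ/= pA.1 pB.1.
  rewrite scaleAE BE -mulmxBl -mulmxBr -linearB/=; apply: quad_le => k.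
  by rewrite !mxE subr_ge0; case/andP: (mu_le k).
have leBA : loewner_le B (expR r *: A).
  split; first by rewrite linearB/= linearZ/= pA.1 pB.1.
  rewrite scaleAE BE -mulmxBl -mulmxBr -linearB/=; apply: quad_le => k.
  by rewrite !mxE subr_ge0; case/andP: (mu_le k).
have pAr := posdefmxZ (expR_gt0 r) pA.
have pAr' := posdefmxZ (expR_gt0 (- r)) pA.
have := dhat_le i pAr' pB leAB; have := dhat_le i pB pAr leBA.
rewrite !dhatZ ?expR_gt0// => leB geB.
have a_gt0 := dhat_gt0 i pA; have b_gt0 := dhat_gt0 i pB.
rewrite ler_norml -ler_expR -[X in _ && X]ler_expR lnK ?posrE ?divr_gt0//.
by rewrite ler_pdivlMr// ler_pdivrMr// leB geB.
Qed.

Theorem theorem2p5 (R : realType) (n : nat) :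
  (forall A B : 'M[R]_(n + n), posdefmx A -> posdefmx B ->
     loewner_le A B -> forall i, dhat A 0 i <= dhat B 0 i)
  /\
  (forall A B : 'M[R]_(n + n), posdefmx A -> posdefmx B ->
     thompson_dist (diag_mx (dhat A)) (diag_mx (dhat B)) <= thompson_dist A B
     /\
     riem_dist (diag_mx (dhat A)) (diag_mx (dhat B))
       <= Num.sqrt (2 * n)%:R * riem_dist A B).
Proof.
split=> [A B pA pB AB i|A B pA pB]; first exact: dhat_le.
have [U [V [mu [UU mu_gt0 AE BE logE]]]] := log_ratio_spec pA pB.
have bound := dhat_log_ratio pA pB AE BE mu_gt0.
rewrite /thompson_dist /riem_dist logE log_ratio_diag; last first.
  by move=> i; apply: dhat_gt0.
split.
  apply: op_norm_diag_le => [|i].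
    exact: op_norm_ge0.
  rewrite mxE; apply: bound => {}i.
  by have := ler_op_norm (map_mx (@ln R) mu) i UU; rewrite mxE.
set r := frob_norm (U^T *m _ *m U).
have r_ge0 : 0 <= r by exact: sqrtr_ge0.
have rE : r ^+ 2 = \sum_i ln (mu 0 i) ^+ 2.
  rewrite /r frob_normE// sqr_sqrtr; last first.
    by apply: sumr_ge0 => i _; exact: sqr_ge0.
  by apply: eq_bigr => i _; rewrite mxE.
(* A single square is at most the whole sum, so the Riemannian distance bounds every |ln mu_i|. *)
have mu_r i : `|ln (mu 0 i)| <= r.
  rewrite -(@ler_pXn2r _ 2)// real_normK ?num_real// rE (bigD1 i)//= lerDl.
  by apply: sumr_ge0 => k _; exact: sqr_ge0.
have := @frob_normE R (n + n) 1%:M (\row_i ln (dhat B 0 i / dhat A 0 i)).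
rewrite trmx1 !mul1mx !mulmx1 => /(_ erefl) ->.
rewrite -[r]ger0_norm// -sqrtr_sqr -sqrtrM ?ler0n// ler_wsqrtr//.
(* Each of the 2n squares is bounded by r^2 separately, whence the factor sqrt(2n). *)
apply: le_trans (_ : \sum_(i < n + n) r ^+ 2 <= _).
  apply: ler_sum => i _; rewrite mxE -[X in X <= _]real_normK ?num_real//.
  by rewrite ler_pXn2r ?nnegrE// bound.
by rewrite sumr_const card_ord mul2n addnn mulr_natl.
Qed.
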